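(* Let $\mathcal{P}\subset\Delta(\mathcal{S})^{\mathcal{S}\times\mathcal{A}}$ be a nonempty compact (not necessarily convex) uncertainty set that is weakly s-tractable. Let $r\in\mathbb{R}^{\mathcal{S}\times\mathcal{A}}$, $\gamma\in(0,1)$ and $\mu\in\Delta(\mathcal{S})$. Then $$\max_{\pi\in\Pi_{\mathsf S}}\min_{P\in\mathcal{P}}\mu^\top v^{\pi,P}=\mu^\top u^\star .$$ Additionally, for any $\pi^\star\in\Pi_{\mathsf S}$ such that $u^\star=u^{\pi^\star}$, we have $$\pi^\star\in\arg\max_{\pi\in\Pi_{\mathsf S}}\min_{P\in\mathcal{P}}\mu^\top v^{\pi,P}.$$
   Context: $\mathcal{S}$ (states) and $\mathcal{A}$ (actions) are finite nonempty sets; $\Delta(E)$ denotes the set of probability distributions on a finite set $E$. Elements of an uncertainty set $\mathcal{P} \subset \Delta(\mathcal{S})^{\mathcal{S}\times\mathcal{A}}$ are written $P=(P_{sa})_{(s,a)}$ with $P_{sa}\in\Delta(\mathcal{S})\subset\mathbb{R}^{\mathcal{S}}$. Stationary policies: $\Pi_{\mathsf S}=\Delta(\mathcal{A})^{\mathcal{S}}$, $\pi=(\pi_{sa})$. Rewards are independent of the next state: $r=(r_{sa})\in\mathbb{R}^{\mathcal{S}\times\mathcal{A}}$. For $\gamma\in[0,1)$, $\pi\in\Pi_{\mathsf S}$, $P\in\mathcal{P}$: $v^{\pi,P}_s=\mathbb{E}^{\pi,P}\big[\sum_{t\ge 0}\gamma^t r_{s_ta_t}\,\big|\,s_0=s\big]$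 (with $0^0=1$), where $a_t\sim\pi_{s_t}$, $s_{t+1}\sim P_{s_ta_t}$. $u^{\pi}\in\mathbb{R}^{\mathcal{S}}$ is the unique vector satisfying $u^\pi_s=\min_{P\in\mathcal{P}}\sum_{a}\pi_{sa}(r_{sa}+\gamma P_{sa}^\top u^\pi)$ for all $s$. $u^\star\in\mathbb{R}^{\mathcal{S}}$ is the unique vector satisfying $u^\star_s=\max_{\pi\in\Pi_{\mathsf S}}\min_{P\in\mathcal{P}}\sum_{a}\pi_{sa}(r_{sa}+\gamma P_{sa}^\top u^\star)$ for all $s$. $\mathcal{P}$ is weakly s-tractable if for all $\pi\in\Pi_{\mathsf S}$, $r\in\mathbb{R}^{\mathcal{S}\times\mathcal{A}}$, $\gamma\in[0,1)$, $\mu\in\Delta(\mathcal{S})$: $\min_{P\in\mathcal{P}}\mu^\top v^{\pi,P}=\mu^\top u^\pi$. *)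

(* Defs.v *)
(* MathComp-Analysis *)
From HB Require Import structures.
From mathcomp Require Import all_boot all_order all_algebra.
From mathcomp Require Import all_classical all_reals all_analysis.
Import Order.TTheory GRing.Theory Num.Theory numFieldNormedType.Exports.

Set Implicit Arguments.
Unset Strict Implicit.
Unset Printing Implicit Defensive.

Local Open Scope classical_set_scope.
Local Open Scope ring_scope.

(* Minima and maxima are attained, unlike [inf] and [sup]. *)
Definition is_min (R : realType) (X : set R) (m : R) : Prop :=
  X m /\ lbound X m.

Definition is_max (R : realType) (X : set R) (m : R) : Prop :=
  X m /\ ubound X m.

(* max_{p in D} min_{q in E} f p q = x, where g is the map p |-> min_q f p q;
   all the minima and the maximum are required to be attained. *)
Definition is_maxmin (R : realType) (T1 T2 : Type) (D : set T1) (E : set T2)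
    (f : T1 -> T2 -> R) (x : R) : Prop :=
  exists2 g : T1 -> R,
    (forall p, D p -> is_min [set f p q | q in E] (g p)) &
    is_max [set g p | p in D] x.

Definition argmaxmin (R : realType) (T1 T2 : Type) (D : set T1) (E : set T2)
    (f : T1 -> T2 -> R) : set T1 :=
  [set p | D p /\
     exists2 x, is_maxmin D E f x & is_min [set f p q | q in E] x].

Definition simplex (R : realType) (E : finType) : set (E -> R) :=
  [set p | (forall e, 0 <= p e) /\ \sum_e p e = 1].

Definition dotp (R : realType) (S : finType) (x y : S -> R) : R :=
  \sum_s x s * y s.

Definition policies (R : realType) (S A : finType) : set (S -> A -> R) :=
  [set pi | forall s, simplex (pi s)].

(* The type S -> A -> S -> R with its pointwise topology, which is the
   Euclidean one since S and A are finite. *)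
Definition kernel_space (R : realType) (S A : finType) :=
  {ptws S -> {ptws A -> {ptws S -> R}}}.

Definition transition_kernels (R : realType) (S A : finType) :
    set (kernel_space R S A) :=
  [set P | forall s a, simplex (P s a)].

(* The process (X_t, Y_t) of states and actions on the probability space
   (W, Q) starts at s and satisfies Y_t ~ pi_{X_t}, X_{t+1} ~ P_{X_t Y_t}:
   this is stated as the law of its trajectories up to each horizon n. *)
Definition decision_process (R : realType) (S A : finType)
    (pi : S -> A -> R) (P : S -> A -> S -> R) (s : S)
    (d : measure_display) (W : measurableType d) (Q : probability W R)
    (X : nat -> W -> S) (Y : nat -> W -> A) : Prop :=
  [/\ (forall t x, measurable [set w | X t w = x]),
      (forall t a, measurable [set w | Y t w = a]) &
      forall (n : nat) (x : nat -> S) (a : nat -> A),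
        Q [set w | forall t, (t <= n)%N -> X t w = x t /\ Y t w = a t] =
        ((x 0%N == s)%:R * (\prod_(t < n.+1) pi (x t) (a t)) *
         (\prod_(t < n) P (x t) (a t) (x t.+1)))%:E].

Definition discounted_return (R : realType) (S A : finType) (r : S -> A -> R)
    (gamma : R) (W : Type) (X : nat -> W -> S) (Y : nat -> W -> A) : W -> R :=
  fun w => limn [series gamma ^+ t * r (X t w) (Y t w)]_t.

(* A process as above exists and its law is determined by pi, P and s
   (Ionescu-Tulcea), so that [get] picks from a singleton whenever pi is a
   policy, P is a transition kernel and 0 <= gamma < 1. *)
Definition value (R : realType) (S A : finType) (r : S -> A -> R) (gamma : R)
    (pi : S -> A -> R) (P : S -> A -> S -> R) : S -> R :=
  fun s => get [set v : R |
    exists (d : measure_display) (W : measurableType d) (Q : probability W R)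
      (X : nat -> W -> S) (Y : nat -> W -> A),
      decision_process pi P s Q X Y /\
      v%:E = ('E_Q[discounted_return r gamma X Y])%E].

Definition backup (R : realType) (S A : finType) (r : S -> A -> R) (gamma : R)
    (u : S -> R) (s : S) (pi : S -> A -> R) (P : S -> A -> S -> R) : R :=
  \sum_a pi s a * (r s a + gamma * dotp (P s a) u).

(* [get] picks an element of the set; for a nonempty compact set of transition
   kernels and 0 <= gamma < 1, it is the only one. *)
Definition u_policy (R : realType) (S A : finType) (U : set (kernel_space R S A))
    (r : S -> A -> R) (gamma : R) (pi : S -> A -> R) : S -> R :=
  get [set u : S -> R |
    forall s, is_min [set backup r gamma u s pi P | P in U] (u s)].

Definition u_star (R : realType) (S A : finType) (U : set (kernel_space R S A))
    (r : S -> A -> R) (gamma : R) : S -> R :=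
  get [set u : S -> R |
    forall s, is_maxmin (@policies R S A) U (backup r gamma u s) (u s)].

Definition weakly_s_tractable (R : realType) (S A : finType)
    (U : set (kernel_space R S A)) : Prop :=
  forall (pi : S -> A -> R) (r : S -> A -> R) (gamma : R) (mu : S -> R),
    policies pi -> 0 <= gamma < 1 -> simplex mu ->
    is_min [set dotp mu (value r gamma pi P) | P in U]
           (dotp mu (u_policy U r gamma pi)).

(* Main.v *)
Require Import Defs.
From mathcomp Require Import all_boot all_order all_algebra.
From mathcomp Require Import all_classical all_reals all_analysis.
From mathcomp Require Import ring lra.
Import Order.TTheory GRing.Theory Num.Theory numFieldNormedType.Exports.

(** For each policy [pi], tractability says that the worst-case value of [pi]
    is [dotp mu u^pi], where [u^pi] is the fixed point of the robust evaluation
    operator of [pi].  The expected returns themselves therefore never have to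
    be computed, and the theorem becomes a statement about Bellman equations:
    among the vectors [u^pi], the fixed point [u^*] of the max-min operator is
    the greatest one, and it is attained.

    Both halves follow from one comparison principle, [backup_comparison]:
    [u <= v] everywhere as soon as, in each state, some policy and some kernel
    have a one-step backup that does not lower [u] and does not raise [v].
    The reason is that a backup contracts a constant shift by [gamma], so that
    the largest value of [u - v] is at most [gamma] times itself.
    - [u^pi <= u^*]: the witnesses are [pi] and a kernel that is worst for
      [pi] against [u^*] ([u_policy_le_u_star]).
    - [u^* = u^pi] for some [pi]: the maximisers in the separate states
      assemble into one stationary policy, because a backup in [s] reads a
      policy only at [s]; the comparison then works in the other direction
      ([u_star_attained]).

    Since [u^pi] and [u^*] are chosen by a choice operator, these arguments
    also need solutions of both equations to exist.  The evaluation equation of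
    [pi] is the max-min equation over the one-policy set [{pi}], so that
    [maxmin_fixed_point] treats the two together: [compact_maxmin] shows that
    the max-min is attained over compact sets of policies and kernels, and the
    order-theoretic [monotone_fixed_point] produces a fixed point of the
    resulting monotone operator, the comparison with a large constant vector
    bounding its subsolutions. *)

Set Implicit Arguments.
Unset Strict Implicit.
Unset Printing Implicit Defensive.

Local Open Scope classical_set_scope.
Local Open Scope ring_scope.

(** * Attained max-min values *)

Lemma maxmin_attained (R : realType) (T1 T2 : Type) (D : set T1) (E : set T2)
    (f : T1 -> T2 -> R) (x : R) :
  is_maxmin D E f x -> exists2 p, D p & is_min [set f p q | q in E] x.
Proof. by move=> [g gmin [[p Dp <-] _]]; exists p => //; exact: gmin. Qed.

Lemma maxmin_ge (R : realType) (T1 T2 : Type) (D : set T1) (E : set T2)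
    (f : T1 -> T2 -> R) (x : R) (p : T1) :
  is_maxmin D E f x -> D p -> exists2 q, E q & f p q <= x.
Proof.
move=> [g gmin [_ gx]] Dp; have [[q Eq fpq] _] := gmin p Dp.
by exists q => //; rewrite fpq; apply: gx; exists p.
Qed.

Lemma maxmin_le (R : realType) (T1 T2 : Type) (D : set T1) (E : set T2)
    (f g : T1 -> T2 -> R) (x y : R) :
  (forall p q, D p -> E q -> f p q <= g p q) ->
  is_maxmin D E f x -> is_maxmin D E g y -> x <= y.
Proof.
move=> fg /maxmin_attained[p Dp [_ xmin]] ymaxmin.
have [q Eq gy] := maxmin_ge ymaxmin Dp.
apply: le_trans gy; apply: le_trans (fg _ _ Dp Eq).
by apply: xmin; exists q.
Qed.

(** This identifies the evaluation equation of one policy with an instance of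
    the max-min equation. *)
Lemma maxmin_set1 (R : realType) (T1 T2 : Type) (p : T1) (E : set T2)
    (f : T1 -> T2 -> R) (x : R) :
  is_maxmin [set p] E f x -> is_min [set f p q | q in E] x.
Proof. by move=> /maxmin_attained[_ ->]. Qed.

(** The map [g p = min_q f p q] is a minimum of continuous functions, hence
    upper semicontinuous, and such a map has a maximum on a compact set: the
    superlevel sets of [g] in [D] form a filter base, and [g] is maximal at
    any cluster point of it. *)
Lemma compact_maxmin (R : realType) (T1 T2 : topologicalType)
    (D : set T1) (E : set T2) (f : T1 -> T2 -> R) :
  D !=set0 -> compact D -> E !=set0 -> compact E ->
  (forall q, continuous (f ^~ q)) -> (forall p, continuous (f p)) ->
  exists x, is_maxmin D E f x.
Proof.
move=> [p0 Dp0] cD E0 cE fcont1 fcont2.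
have min_ex p : exists m, is_min [set f p q | q in E] m.
  have [q /set_mem Eq qmin] := compact_EVT_min E0 cE
    (continuous_subspaceT (fcont2 p)).
  exists (f p q); split; first by exists q.
  by move=> _ [q' Eq' <-]; apply: qmin; exact/mem_set.
have [g gmin] := choice min_ex.
pose above p' := [set p | D p /\ g p' <= g p].
have aboveF : ProperFilter (filter_from D above).
  apply: filter_from_proper; last by move=> p Dp; exists p.
  apply: filter_from_filter; first by exists p0.
  move=> p1 p2 Dp1 Dp2; have [le12|/ltW le21] := leP (g p1) (g p2).
    by exists p2 => // p [Dp le2p]; do 2!split => //; exact: le_trans le2p.
  by exists p1 => // p [Dp le1p]; do 2!split => //; exact: le_trans le1p.
have [p [Dp pclus]] : D `&` cluster (filter_from D above) !=set0.
  by apply: cD; exists p0 => // p [].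
exists (g p); exists g => //; split; first by exists p.
(* If g p < g p', the minimiser q of f p keeps f _ q, and so g, below g p'
   near p; but points with g p' <= g lie arbitrarily close to p. *)
move=> _ [p' Dp' <-]; rewrite leNgt; apply/negP => lt_pp'.
have [[q Eq fpq] _] := gmin p.
have near_p : nbhs p ((f ^~ q) @^-1` [set y | y < g p']).
  by apply: fcont1; apply: open_nbhs_nbhs; split=> [|/=];
    [exact: open_lt|rewrite fpq].
have [p1 [[Dp1 le_p'1] /= lt_1p']] :=
  pclus (above p') _ (ex_intro2 _ _ p' Dp' (fun _ => id)) near_p.
have [_ min1] := gmin p1.
have le_1q : g p1 <= f p1 q by apply: min1; exists q.
by move: (le_lt_trans (le_trans le_p'1 le_1q) lt_1p'); rewrite ltxx.
Qed.

(** * Fixed points of monotone operators *)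

(** Knaster-Tarski: the pointwise supremum of the subsolutions [u <= T u] is a
    subsolution, hence so is its image, which the supremum then dominates.  The
    lattice of functions is not complete; [w] and [k] ensure that the suprema
    exist. *)
Lemma monotone_fixed_point (R : realType) (S : Type)
    (T : (S -> R) -> S -> R) (w k : S -> R) :
  (forall u v, (forall s, u s <= v s) -> forall s, T u s <= T v s) ->
  (forall s, w s <= T w s) ->
  (forall u, (forall s, u s <= T u s) -> forall s, u s <= k s) ->
  exists u, forall s, T u s = u s.
Proof.
move=> Tmono wT subk.
pose X s := [set u s | u in [set u | forall s, u s <= T u s]].
pose x s := sup (X s).
have X0 s : X s !=set0 by exists (w s), w.
have Xk s : ubound (X s) (k s) by move=> _ [u uT <-]; exact: subk.
have xub u : (forall s, u s <= T u s) -> forall s, u s <= x s.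
  by move=> uT s; apply: ub_le_sup; [exists (k s)|exists u].
have xT s : x s <= T x s.
  apply: ge_sup => // _ [u uT <-]; apply: le_trans (uT s) _.
  by apply: Tmono; exact: xub.
exists x => s; apply/eqP; rewrite eq_le xT andbT.
by apply: (xub (T x)) => t; exact: Tmono.
Qed.

(** * One-step backups and the comparison principle *)

Lemma simplex_average_le (R : realType) (E : finType) (p f : E -> R) (c : R) :
  simplex p -> (forall e, f e <= c) -> \sum_e p e * f e <= c.
Proof.
move=> [p0 p1] fc; rewrite -[leRHS]mul1r -p1 mulr_suml.
by apply: ler_sum => e _; exact: ler_wpM2l.
Qed.

Lemma backup_le (R : realType) (S A : finType) (r : S -> A -> R) (gamma : R)
    (u v : S -> R) (d : R) (s : S) (pi : S -> A -> R) (P : S -> A -> S -> R) :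
  0 <= gamma -> simplex (pi s) -> (forall a, simplex (P s a)) ->
  (forall t, u t <= v t + d) ->
  backup r gamma u s pi P <= backup r gamma v s pi P + gamma * d.
Proof.
move=> g0 pis Ps uv; rewrite -lerBlDl -sumrB.
under eq_bigr => a _ do rewrite -mulrBr opprD addrACA subrr add0r -mulrBr.
apply: simplex_average_le => // a; apply: ler_wpM2l => //.
rewrite /dotp -sumrB; under eq_bigr => t _ do rewrite -mulrBr.
by apply: simplex_average_le => // t; rewrite lerBlDl.
Qed.

Lemma backup_cst (R : realType) (S A : finType) (r : S -> A -> R) (gamma k : R)
    (s : S) (pi : S -> A -> R) (P : S -> A -> S -> R) :
  simplex (pi s) -> (forall a, simplex (P s a)) ->
  backup r gamma (fun=> k) s pi P = \sum_a pi s a * r s a + gamma * k.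
Proof.
move=> [_ pis] Ps; rewrite /backup.
under eq_bigr => a _ do rewrite /dotp -mulr_suml (Ps a).2 mul1r mulrDr.
by rewrite big_split /= -mulr_suml pis mul1r.
Qed.

(** At a state [m] where [u - v] is largest, with value [d], the hypothesis
    gives [d <= gamma * d], and [gamma < 1] forces [d <= 0]. *)
Lemma backup_comparison (R : realType) (S A : finType) (r : S -> A -> R)
    (gamma : R) (u v : S -> R) :
  0 <= gamma < 1 ->
  (forall s, exists pi P, [/\ policies pi, @transition_kernels R S A P,
     u s <= backup r gamma u s pi P & backup r gamma v s pi P <= v s]) ->
  forall s, u s <= v s.
Proof.
move=> /andP[g0 g1] uv s0.
have [m mmax] : exists m, forall t, u t - v t <= u m - v m.
  exists [arg max_(i > s0) (u i - v i)]%O => t.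
  by case: arg_maxP => // i _; exact.
suff dle : u m - v m <= 0 by rewrite -subr_le0; exact: le_trans (mmax s0) dle.
have [pi [P [pip PK um vm]]] := uv m.
have le_d : u m - v m <= gamma * (u m - v m).
  rewrite lerBlDr; apply: (le_trans um).
  have u_shift t : u t <= v t + (u m - v m) by rewrite -lerBlDl.
  apply: le_trans (backup_le r g0 (pip m) (PK m) u_shift) _.
  by rewrite addrC lerD2l.
nra.
Qed.

(** * Continuity of backups and compactness of the set of policies *)

Lemma continuous_sum (R : realType) (T : topologicalType) (I : finType)
    (f : I -> T -> R) :
  (forall i, continuous (f i)) -> continuous (fun x => \sum_i f i x).
Proof. by move=> fcont; apply: continuous_big => //; exact: add_continuous. Qed.

Lemma continuous_entry (I : eqType) (T : topologicalType) (i : I) :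
   continuous (fun f : {ptws I -> T} => f i).
Proof. exact: (@proj_continuous _ (fun=> T) i). Qed.

Lemma continuous_comp_entry (I : eqType) (T T' : topologicalType)
    (f : T -> {ptws I -> T'}) (i : I) :
  continuous f -> continuous (fun x => f x i).
Proof.
move=> fc x; apply: (@continuous_comp _ _ _ f (fun g => g i)); first exact: fc.
exact: continuous_entry.
Qed.

Lemma continuous_entry2 (I J : eqType) (T : topologicalType) (i : I) (j : J) :
  continuous (fun f : {ptws I -> {ptws J -> T}} => f i j).
Proof.
apply: (@continuous_comp_entry J {ptws I -> {ptws J -> T}} T (fun f => f i)).
exact: continuous_entry.
Qed.

Lemma continuous_entry3 (I J K : eqType) (T : topologicalType) (i : I) (j : J)
    (k : K) :
  continuous (fun f : {ptws I -> {ptws J -> {ptws K -> T}}} => f i j k).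
Proof.
apply: (@continuous_comp_entry K {ptws I -> {ptws J -> {ptws K -> T}}} T
  (fun f => f i j)).
exact: continuous_entry2.
Qed.

(** The policy and the kernel both vary with a parameter [x], so that one
    statement gives continuity in either of them. *)
Lemma continuous_backup (R : realType) (S A : finType) (r : S -> A -> R)
    (gamma : R) (u : S -> R) (s : S) (T : topologicalType)
    (pi : T -> S -> A -> R) (P : T -> S -> A -> S -> R) :
  (forall a, continuous (fun x => pi x s a)) ->
  (forall a t, continuous (fun x => P x s a t)) ->
  continuous (fun x => backup r gamma u s (pi x) (P x)).
Proof.
move=> pic Pc; apply: continuous_sum => a x.
apply: cvgM; first exact: pic.
apply: cvgD; first exact: cvg_cst.
apply: cvgM; first exact: cvg_cst.
apply: continuous_sum => t {}x.
by apply: cvgM; [exact: Pc|exact: cvg_cst].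
Qed.

(** A closed subset of the cube, which is compact by Tychonoff's theorem. *)
Lemma compact_simplex (R : realType) (E : finType) :
  compact (@simplex R E : set {ptws E -> R}).
Proof.
have cube : compact [set p : {ptws E -> R} | forall e, `[0, 1]%classic (p e)].
  apply: (@tychonoff E (fun=> R) (fun=> `[0, 1]%classic)) => e.
  exact: segment_compact.
have sum1 : closed [set p : {ptws E -> R} | \sum_e p e = 1].
  apply: (@preimage_closed _ _ (fun p : {ptws E -> R} => \sum_e p e) [set 1]).
    by move=> p _; apply: continuous_sum => e; exact: continuous_entry.
  exact: closed_eq.
rewrite (_ : @simplex R E =
  [set p : E -> R | forall e, `[0, 1]%classic (p e)] `&`
  [set p | \sum_e p e = 1]).
  exact: compact_closedI.
apply/seteqP; split=> p [p0 p1]; split=> // e; last first.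
  by have /= := p0 e; rewrite in_itv /= => /andP[].
rewrite /= in_itv /= p0 -p1 (bigD1 e) //= lerDl.
by apply: sumr_ge0.
Qed.

Lemma compact_policies (R : realType) (S A : finType) :
  compact (@policies R S A : set {ptws S -> {ptws A -> R}}).
Proof.
apply: (@tychonoff S (fun=> {ptws A -> R}) (fun=> @simplex R A)) => s.
exact: compact_simplex.
Qed.

Lemma policies_neq0 (R : realType) (S A : finType) :
  (0 < #|A|)%N -> @policies R S A !=set0.
Proof.
move=> /card_gt0P[a _]; exists (fun _ b => (b == a)%:R) => s; split => [b|].
  exact: ler0n.
by rewrite (bigD1 a) //= eqxx big1 ?addr0 // => b /negbTE ->.
Qed.

(** * Solutions of the robust Bellman equations *)

Section RobustBellman.
Context (R : realType) (S A : finType) (U : set (kernel_space R S A)).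
Context (hU : U `<=` @transition_kernels R S A) (U0 : U !=set0)
  (Uc : compact U).
Context (r : S -> A -> R) (gamma : R) (hg : 0 <= gamma < 1).

(** Allowing any compact [D] covers both the set of all policies, whose
    equation defines [u_star], and the singletons, whose equations define the
    [u_policy]. *)
Lemma maxmin_fixed_point (D : set (S -> A -> R)) :
  D `<=` @policies R S A -> D !=set0 ->
  compact (D : set {ptws S -> {ptws A -> R}}) ->
  exists u, forall s, is_maxmin D U (backup r gamma u s) (u s).
Proof.
move=> DK D0 Dc; have /andP[g0 g1] := hg.
have bellman_ex (us : (S -> R) * S) :
    exists x, is_maxmin D U (backup r gamma us.1 us.2) x.
  apply: (@compact_maxmin R {ptws S -> {ptws A -> R}} (kernel_space R S A)) => //.
    move=> P; apply: (@continuous_backup _ _ _ _ _ _ _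
      {ptws S -> {ptws A -> R}} id (fun=> P)) => *; last exact: cst_continuous.
    exact: continuous_entry2.
  move=> pi; apply: (@continuous_backup _ _ _ _ _ _ _
    (kernel_space R S A) (fun=> pi) id) => *; first exact: cst_continuous.
  exact: continuous_entry3.
have [T' T'P] := choice bellman_ex.
pose T u s := T' (u, s).
have TP u s : is_maxmin D U (backup r gamma u s) (T u s) := T'P (u, s).
pose C := \sum_s \sum_a `|r s a|.
have rC s a : `|r s a| <= C.
  rewrite /C (bigD1 s) //= (bigD1 a) //= -addrA lerDl addr_ge0 ?sumr_ge0 // => *.
  by rewrite sumr_ge0.
(* k is the return of earning C forever: the constants -k and k are a
   subsolution and a supersolution. *)
pose k := C / (1 - gamma).
have kE : k = C + gamma * k by rewrite /k; field; rewrite subr_eq0 gt_eqF.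
suff [u uP] : exists u, forall s, T u s = u s.
  by exists u => s; rewrite -[X in is_maxmin _ _ _ X]uP.
apply: (@monotone_fixed_point _ _ T (fun=> - k) (fun=> k)).
- move=> u v uv s; apply: maxmin_le (TP u s) (TP v s) => pi P Dpi UP.
  rewrite -[leRHS]addr0 -[X in _ + X](mulr0 gamma).
  by apply: backup_le => // [|a|t]; [exact: DK|exact: hU|rewrite addr0].
- move=> s; have [pi Dpi] := D0.
  have [P UP] := maxmin_ge (TP (fun=> - k) s) Dpi; apply: le_trans.
  rewrite backup_cst; [|exact: DK|by move=> a; exact: hU].
  rewrite {1}kE opprD mulrN lerB // lerNl -sumrN.
  under eq_bigr => a _ do rewrite -mulrN.
  apply: simplex_average_le => [|a]; first exact: DK.
  by rewrite (le_trans _ (rC s a)) // -normrN ler_norm.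
- move=> u uT; apply: (backup_comparison hg (r := r)) => s.
  have [pi Dpi [_ pimin]] := maxmin_attained (TP u s); have [P UP] := U0.
  exists pi, P; split; [exact: DK|exact: hU| |].
    by apply: le_trans (uT s) _; apply: pimin; exists P.
  rewrite backup_cst; [|exact: DK|by move=> a; exact: hU].
  rewrite [leRHS]kE lerD2r; apply: simplex_average_le => [|a]; first exact: DK.
  exact: le_trans (ler_norm _) (rC s a).
Qed.

Lemma u_policyP (pi : S -> A -> R) : policies pi ->
  forall s, is_min [set backup r gamma (u_policy U r gamma pi) s pi P | P in U]
                   (u_policy U r gamma pi s).
Proof.
move=> pip; apply: (@getPex _ [set u | forall s,
  is_min [set backup r gamma u s pi P | P in U] (u s)]).
have [] := @maxmin_fixed_point [set pi].
- by move=> _ ->.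
- by exists pi.
- exact: compact_set1.
by move=> u uP; exists u => s; exact: maxmin_set1.
Qed.

Context (hA : (0 < #|A|)%N).

Lemma u_starP s :
  is_maxmin (@policies R S A) U (backup r gamma (u_star U r gamma) s)
            (u_star U r gamma s).
Proof.
move: s; apply: (@getPex _ [set u | forall s,
  is_maxmin (@policies R S A) U (backup r gamma u s) (u s)]).
apply: maxmin_fixed_point => //; first exact: policies_neq0.
exact: compact_policies.
Qed.

Lemma u_policy_le_u_star (pi : S -> A -> R) : policies pi ->
  forall s, u_policy U r gamma pi s <= u_star U r gamma s.
Proof.
move=> pip; apply: (backup_comparison hg (r := r)) => s.
have [P UP leP] := maxmin_ge (u_starP s) pip.
exists pi, P; split => //; first exact: hU.
by have [_] := u_policyP pip s; apply; exists P.
Qed.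

(** A maximising policy is picked in each state [s] and kept only at [s]; as
    the backup in [s] reads the policy nowhere else, the resulting policy
    maximises in all states at once. *)
Lemma u_star_attained :
  exists2 pi : S -> A -> R, policies pi &
    u_star U r gamma = u_policy U r gamma pi.
Proof.
have [pis pisP] := choice (fun s => let: ex_intro2 pi pip pimin :=
  maxmin_attained (u_starP s) in ex_intro _ pi (conj pip pimin)).
pose pi s := pis s s.
have pip : policies pi by move=> s; exact: (pisP s).1.
exists pi => //; apply/funext => s; apply/eqP.
rewrite eq_le u_policy_le_u_star // andbT; move: s.
apply: (backup_comparison hg (r := r)) => s.
have [[P UP uP] _] := u_policyP pip s.
exists pi, P; split => //; [exact: hU| |by rewrite uP].
by have [_ [_ /(_ _ (ex_intro2 _ _ P UP erefl))]] := pisP s.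
Qed.

End RobustBellman.

Theorem theorem6 (R : realType) (S A : finType)
  (hS : (0 < #|S|)%N) (hA : (0 < #|A|)%N)
  (U : set (kernel_space R S A))
  (hU : U `<=` @transition_kernels R S A)
  (hU0 : U !=set0) (hUc : compact U)
  (htract : weakly_s_tractable U)
  (r : S -> A -> R) (gamma : R) (hgamma : 0 < gamma < 1)
  (mu : S -> R) (hmu : simplex mu) :
  is_maxmin (@policies R S A) U
    (fun pi P => dotp mu (value r gamma pi P))
    (dotp mu (u_star U r gamma))
  /\
  (forall pistar : S -> A -> R, policies pistar ->
     u_star U r gamma = u_policy U r gamma pistar ->
     argmaxmin (@policies R S A) U
       (fun pi P => dotp mu (value r gamma pi P)) pistar).
Proof.
have hg : 0 <= gamma < 1 by case/andP: hgamma => /ltW -> ->.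
have maxmin : is_maxmin (@policies R S A) U
    (fun pi P => dotp mu (value r gamma pi P)) (dotp mu (u_star U r gamma)).
  exists (fun pi => dotp mu (u_policy U r gamma pi)).
    by move=> pi pip; exact: htract.
  split.
    have [pi pip ->] := u_star_attained hU hU0 hUc r hg hA.
    by exists pi.
  move=> _ [pi pip <-]; apply: ler_sum => s _.
  by apply: ler_wpM2l; [exact: hmu.1|exact: u_policy_le_u_star].
split=> // pistar pip upi; split=> //.
by exists (dotp mu (u_star U r gamma)) => //; rewrite upi; exact: htract.
Qed.
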